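(* Let $f \in H^2_w$ be a monic polynomial with $f(0) \neq 0$. Suppose $f$ has distinct zeros $\beta_1, \ldots, \beta_r$ with multiplicities $m_1, \ldots, m_r$, respectively. For each integer $j\ge 0$ let $Z_j := \{ \beta_i : 1\le i\le r,\ \beta_i\in\Omega_j(H^2_w),\ m_i > j \}$ be the set of zeros of $f$ that are reproducible of order $j$ and have multiplicity greater than $j$, and let $I_j := \{ i \in \{ 1, \ldots, r\} : \beta_i \in Z_j \}$. Let $R:= \max\{ j: Z_j \neq \emptyset\}$ be the largest value of $j$ such that $Z_j$ is non-empty (if all $Z_j$ are empty, the sum below is interpreted as $0$). Let $\varphi$ be the orthogonal projection of $1$ onto $[f]$ in $H^2_w$. Then $$\varphi(z) = 1 + \sum_{j=0}^{R} \ \sum_{i \in I_j} C_{i,j}\, k_{\beta_i}^{j}(z),$$ where $k_\beta^j$ denotes the reproducing kernel for $j$-th derivatives in $H^2_w$ at $\beta$ and the $C_{i,j}$ are constants determined by the conditions $\langle \varphi, k_{\beta_i}^j \rangle_w = 0$ for each $i \in I_j$ and $0 \le j \le R$.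
   Context: Let $w=\{w_k\}_{k\ge0}$ be a sequence of positive real numbers with $w_0=1$ and $\lim_{k\to\infty}w_{k+1}/w_k=1$. $H^2_w$ is the Hilbert space of functions $h(z)=\sum_{k\ge0}a_kz^k$, $|z|<1$, with $\|h\|_w^2=\sum_{k\ge 0} w_k|a_k|^2<\infty$, with inner product $\langle \sum a_kz^k,\sum b_kz^k\rangle_w=\sum_{k\ge 0} w_ka_k\overline{b_k}$. $[f]$ is the closure in $H^2_w$ of $\mathrm{span}\{z^nf:n\ge0\}$. For $\beta\in\mathbb{C}$ and an integer $m\ge0$, $\beta$ is reproducible of order $m$ in $H^2_w$ if evaluation at $\beta$ of the $m$-th derivative of functions in $H^2_w$, $h\mapsto h^{(m)}(\beta)$ (for $|\beta|\ge1$, computed by termwise differentiation of the Maclaurin series), is a well-defined bounded linear functional on $H^2_w$; $\Omega_m(H^2_w)$ is the set of such $\beta$. For $\beta\in\Omega_m(H^2_w)$, $k_\beta^m\in H^2_w$ is the reproducing kernel for $m$-th derivatives: $\langle h,k_\beta^m\rangle_w=h^{(m)}(\beta)$ for all $h\in H^2_w$; explicitly $k_\beta^m(z)=\sum_{l\ge0}l(l-1)\cdots(l-m+1)\,\overline{\beta}^{\,l-m}z^l/w_l$ (for $m=0$, $k_\beta^0(z)=\sum_{l\ge 0}\overline{\beta}^{\,l}z^l/w_l$). *)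

(* Defs.v *)
From mathcomp Require Import all_boot all_order all_algebra.
From mathcomp Require Import complex.
From mathcomp Require Import all_classical all_reals all_analysis.
Set Implicit Arguments.
Unset Strict Implicit.
Unset Printing Implicit Defensive.
Import Order.TTheory GRing.Theory Num.Theory.
Import numFieldNormedType.Exports.
Local Open Scope ring_scope.
Local Open Scope complex_scope.
Local Open Scope classical_set_scope.

(* A function h(z) = \sum_k a_k z^k of H^2_w is represented by its sequence of
   Maclaurin coefficients a : nat -> R[i].  The topology of the complex numbers
   is that of R[i]^o; real-valued moduli are given by normc. *)
Section WeightedHardy.
Context (R : realType) (w : nat -> R).
Implicit Types (a b h k : nat -> R[i]) (m : nat) (beta : R[i]).

Definition H2w : set (nat -> R[i]) :=
  [set a | cvgn (series (fun l => w l * ComplexField.Normc.normc (a l) ^+ 2))].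

Definition normw a : R :=
  Num.sqrt (limn (series (fun l => w l * ComplexField.Normc.normc (a l) ^+ 2))).

Definition innerw a b : R[i] :=
  limn (series (fun l => (w l)%:C * a l * Num.conj (b l) : R[i]^o)).

(* l-th term of the m-times termwise differentiated series at beta; it vanishes
   for l < m because the falling factorial l ^_ m does. *)
Definition dterm m beta a (l : nat) : R[i]^o :=
  (l ^_ m)%:R * a l * beta ^+ (l - m).

Definition deriv_at m beta a : R[i] := limn (series (dterm m beta a)).

Definition reproducible m beta : Prop :=
  (forall h, H2w h -> cvgn (series (dterm m beta h))) /\
  (exists M : R, forall h, H2w h ->
     ComplexField.Normc.normc (deriv_at m beta h) <= M * normw h).

Definition Omega m : set R[i] := [set beta | reproducible m beta].

Definition is_rep_kernel m beta k : Prop :=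
  H2w k /\ forall h, H2w h -> innerw h k = deriv_at m beta h.

(* Only meaningful for beta in Omega m, where the kernel exists and is unique
   and explicit (rep_kernelP, rep_kernelE below). *)
Definition rep_kernel m beta : nat -> R[i] :=
  xget (fun=> 0) [set k | is_rep_kernel m beta k].

(* coefficients of z^n a(z) *)
Definition mulzn (n : nat) a : nat -> R[i] :=
  fun l => if (l < n)%N then 0 else a (l - n)%N.

Definition shift_span a : set (nat -> R[i]) :=
  [set p | exists N (c : 'I_N -> R[i]),
     p = fun l => \sum_(n < N) c n * mulzn n a l].

(* [a], the closure in H^2_w of span {z^n a : n >= 0} *)
Definition invariant_closure a : set (nat -> R[i]) :=
  [set h | H2w h /\ forall e : R, 0 < e ->
     exists2 p, shift_span a p & normw (fun l => h l - p l) < e].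

Definition is_orth_proj (V : set (nat -> R[i])) a (phi : nat -> R[i]) : Prop :=
  V phi /\ forall h, V h -> innerw (fun l => a l - phi l) h = 0.

(* coefficients of the constant function 1 *)
Definition one_coef : nat -> R[i] := fun l => (l == 0%N)%:R.

Section Zeros.
Context (r : nat) (beta : 'I_r -> R[i]) (mult : 'I_r -> nat).

Definition Zset (j : nat) : set R[i] :=
  [set x | exists i : 'I_r, [/\ x = beta i, Omega j (beta i) & (j < mult i)%N]].

Definition Iset (j : nat) : {set 'I_r} :=
  finset (fun i : 'I_r => `[< Zset j (beta i) >]).

(* The largest j with Zset j nonempty (max_orderP); 0 if there is none.  The
   range of the maximum is harmless as Zset j is empty for j >= max mult. *)
Definition max_order : nat :=
  (\max_(j < \max_(i < r) mult i | `[< Zset j !=set0 >]) j)%N.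

Definition kernel_comb (C : 'I_r -> nat -> R[i]) : nat -> R[i] :=
  fun l => one_coef l +
    \sum_(j < max_order.+1) \sum_(i in Iset j)
      C i j * rep_kernel j (beta i) l.

Lemma max_orderP j : Zset j !=set0 -> Zset max_order !=set0 /\ (j <= max_order)%N.
Proof.
move=> Zj.
have jM : (j < \max_(i < r) mult i)%N.
  by case: Zj => x [i [_ _ ji]]; exact: leq_trans ji (leq_bigmax i).
have jP : `[< Zset (Ordinal jM) !=set0 >] by apply/asboolP.
split; last exact: (@leq_bigmax_cond _ _ (fun i => nat_of_ord i) (Ordinal jM)).
have A0 : (0 < #|[pred i : 'I_(\max_(i < r) mult i) | `[< Zset i !=set0 >]]|)%N.
  by apply/card_gt0P; exists (Ordinal jM).
have [i Pi iE] := eq_bigmax_cond (fun i => nat_of_ord i) A0.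
by rewrite /max_order [X in Zset X]iE; exact/asboolP.
Qed.

End Zeros.

Section Kernel.
Hypothesis w_gt0 : forall l, 0 < w l.

Definition kernel_coef m beta : nat -> R[i] :=
  fun l => (l ^_ m)%:R * Num.conj beta ^+ (l - m) / (w l)%:C.

Let trunc (N : nat) a : nat -> R[i] := fun l => if (l < N)%N then a l else 0.

Lemma cvg_series_finite (K : numFieldType) (u : nat -> K) N :
  (forall l, (N <= l)%N -> u l = 0) -> series u @ \oo --> series u N.
Proof.
move=> u0; apply: cvg_near_cst; exists N => // n /= Nn.
rewrite /series/= (big_cat_nat (n := N))//= [X in _ + X]big_nat_cond [X in _ + X]big1 ?addr0//.
by move=> i /andP[/andP[Ni _] _]; exact: u0.
Qed.

Lemma lim_series_finite (K : numFieldType) (u : nat -> K) N :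
  (forall l, (N <= l)%N -> u l = 0) -> limn (series u) = series u N.
Proof. by move=> /cvg_series_finite /cvg_lim; apply. Qed.

Lemma sqr_normcE (x : R[i]) : (ComplexField.Normc.normc x ^+ 2)%:C = x * Num.conj x.
Proof. by rewrite -normCK rmorphXn. Qed.

Lemma kernel_coefE m beta l (x : R[i]) :
  (w l)%:C * x * Num.conj (kernel_coef m beta l) = (l ^_ m)%:R * x * beta ^+ (l - m).
Proof.
have wJ : Num.conj ((w l)%:C^-1 : R[i]) = (w l)%:C^-1.
  by rewrite fmorphV; congr (_^-1); exact: conjc_real.
rewrite /kernel_coef 2!rmorphM rmorphXn/= wJ conjCK rmorph_nat.
have w0 : ((w l)%:C : R[i]) != 0 by rewrite (inj_eq (@complexI _)) gt_eqF.
set W := (w l)%:C; set F := (l ^_ m)%:R; set B := beta ^+ _.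
by rewrite [F * B / W]mulrC mulrACA divff// mul1r mulrCA mulrA.
Qed.

Lemma innerw_kernel_coef m beta h :
  innerw h (kernel_coef m beta) = deriv_at m beta h.
Proof.
rewrite /innerw /deriv_at; suff -> : (fun l => (w l)%:C * h l *
  Num.conj (kernel_coef m beta l) : R[i]^o) = dterm m beta h by [].
by apply/funext => l; exact: kernel_coefE.
Qed.

Lemma H2w_finite a N : (forall l, (N <= l)%N -> a l = 0) -> H2w a.
Proof.
move=> a0; apply/cvg_ex; eexists; apply: (@cvg_series_finite R _ N) => l Nl.
by rewrite a0// ComplexField.Normc.normc0 expr0n mulr0.
Qed.

Lemma H2w_kernel_coef m beta : reproducible m beta -> H2w (kernel_coef m beta).
Proof.
move=> [_ [M HM]]; set k := kernel_coef m beta.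
set u := fun l => w l * ComplexField.Normc.normc (k l) ^+ 2.
have u_ge0 l : 0 <= u l by rewrite mulr_ge0 ?sqr_ge0 ?ltW.
apply: (@nondecreasing_is_cvgn R (series u)).
  move=> n n' nn'; rewrite /series/= (big_cat_nat (n := n) (p := n'))//=.
  by rewrite lerDl sumr_ge0.
exists (M ^+ 2) => _ [N _ <-].
have S_ge0 : 0 <= series u N by apply: sumr_ge0.
have tr0 l : (N <= l)%N -> trunc N k l = 0 by rewrite /trunc ltnNge => ->.
have nE : normw (trunc N k) = Num.sqrt (series u N).
  rewrite /normw (@lim_series_finite R _ N).
    congr (Num.sqrt _); rewrite /series/=; apply: eq_big_nat => l /andP[_ lN].
    by rewrite /trunc lN.
  by move=> l /tr0 ->; rewrite ComplexField.Normc.normc0 expr0n mulr0.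
have dE : deriv_at m beta (trunc N k) = (series u N)%:C.
  rewrite /deriv_at (@lim_series_finite R[i] _ N).
    rewrite /series/= rmorph_sum/=; apply: eq_big_nat => l /andP[_ lN].
    rewrite /dterm /trunc lN -kernel_coefE -mulrA -sqr_normcE.
    by rewrite -rmorphM.
  by move=> l /tr0 t0; rewrite /dterm t0 mulr0 mul0r.
have := HM _ (H2w_finite tr0); rewrite nE dE.
have -> : ComplexField.Normc.normc (series u N)%:C = series u N.
  by rewrite /ComplexField.Normc.normc /= expr0n addr0 sqrtr_sqr ger0_norm.
set s := Num.sqrt _; have s0 : 0 <= s by exact: sqrtr_ge0.
have -> : series u N = s ^+ 2 by rewrite sqr_sqrtr.
have [->|sn0] := eqVneq s 0; first by rewrite expr0n sqr_ge0.
have sp : 0 < s by rewrite lt_def sn0.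
rewrite expr2 ler_pM2r// => sM; rewrite expr2.
exact: ler_pM.
Qed.

Lemma is_rep_kernel_coef m beta :
  Omega m beta -> is_rep_kernel m beta (kernel_coef m beta).
Proof.
by move=> O; split=> [|h _]; [exact: H2w_kernel_coef|exact: innerw_kernel_coef].
Qed.

Lemma rep_kernelP m beta : Omega m beta -> is_rep_kernel m beta (rep_kernel m beta).
Proof.
move=> O; rewrite /rep_kernel; apply: (xgetPex (fun=> 0)).
by exists (kernel_coef m beta); exact: is_rep_kernel_coef.
Qed.

Lemma is_rep_kernel_uniq m beta k k' :
  is_rep_kernel m beta k -> is_rep_kernel m beta k' -> k = k'.
Proof.
move=> [_ Hk] [_ Hk']; apply/funext => l.
pose d : nat -> R[i] := fun i => (i == l)%:R.
have d0 i : (l.+1 <= i)%N -> d i = 0 by rewrite /d => /gtn_eqF ->.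
have iE b : innerw d b = (w l)%:C * Num.conj (b l).
  rewrite /innerw (@lim_series_finite R[i] _ l.+1).
    rewrite /series/= big_nat_recr//= big_nat_cond big1 ?add0r.
      by rewrite /d eqxx mulr1.
    by move=> i /andP[/andP[_ /ltn_eqF il] _]; rewrite /d il mulr0 mul0r.
  by move=> i /d0 ->; rewrite mulr0 mul0r.
have := Hk' d (H2w_finite d0); rewrite -(Hk d (H2w_finite d0)) !iE.
have w0 : ((w l)%:C : R[i]) != 0 by rewrite (inj_eq (@complexI _)) gt_eqF.
by move=> /(mulfI w0)/(can_inj (@conjCK R[i])).
Qed.

Lemma rep_kernelE m beta : Omega m beta -> rep_kernel m beta = kernel_coef m beta.
Proof.
by move=> O; exact: is_rep_kernel_uniq (rep_kernelP O) (is_rep_kernel_coef O).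
Qed.

End Kernel.
End WeightedHardy.

(* Main.v *)
From HB Require Import structures.
Require Import Defs.
From mathcomp Require Import all_boot all_order all_algebra.
From mathcomp Require Import complex ring lra.
From mathcomp Require Import all_classical all_reals all_analysis.
Import Order.TTheory GRing.Theory Num.Theory.
Import numFieldNormedType.Exports.
Local Open Scope ring_scope.
Local Open Scope complex_scope.
Local Open Scope classical_set_scope.

(**
Put x = 1 - phi and b_l = w_l * conj (x_l).  As phi is the projection of 1 onto
[f], x is orthogonal to every z^n f, which says exactly that
sum_k f_k b_(n+k) = 0 for all n: the sequence b solves the linear recurrence with
characteristic polynomial f.  Hence b is a combination of the sequences
e_(i,j)(l) = l(l-1)...(l-j+1) beta_i^(l-j) with j < m_i, and dividing by w and
conjugating turns e_(i,j) into the coefficients of the kernel k_(beta_i)^j.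

What has to be shown is that only reproducible pairs (i,j) occur.  Now x in H^2_w
means that b lies in the dual space S of sequences with sum |b_l|^2 / w_l finite,
and beta_i is reproducible of order j as soon as e_(i,j) is in S
(reproducible_dual).  Because w_(l+1)/w_l is bounded, S is a vector space stable
under the backward shift T (shift_stable_dual), and for any such space an element
of S killed by f(T) is a combination of those e_(i,j) that lie in S
(recurrence_solution).  Indeed Bezout coefficients split b, inside S, into parts
killed by (T - beta_i)^(m_i), and T - beta_i sends e_(i,j) to a multiple of
e_(i,j-1): applying its powers to a part with top term e_(i,k) puts e_(i,0),
e_(i,1), ..., e_(i,k) in S one after the other (recurrence_primary).

Orthogonality of phi to the kernels holds since the j-th derivative at beta_i is
bounded and annihilates every z^n f (deriv_at_closure).  It determines the
constants: the difference of two candidates is a combination of the kernels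
orthogonal to each of them, hence to itself, hence zero, and the e_(i,j) are
linearly independent (expmono_free, kernel_comb_unique).
*)

Local Notation normc := ComplexField.Normc.normc.
Local Notation Re := complex.Re.
Local Notation Im := complex.Im.

(** * Linear recurrences with constant coefficients *)

Section LinearRecurrences.
Context {F : numFieldType}.
Implicit Types (b x y : nat -> F) (p q : {poly F}) (c : F).

(** Linear extension of X^k |-> b k.  Solving the recurrence with characteristic
    polynomial p means vanishing on the ideal generated by p, which turns the
    manipulation of recurrences into the arithmetic of polynomials. *)
Definition coef_pair b p : F := \sum_(k < size p) p`_k * b k.

Lemma coef_pair_wide n b p :
  (size p <= n)%N -> coef_pair b p = \sum_(k < n) p`_k * b k.
Proof.
move=> pn; rewrite /coef_pair (big_ord_widen _ (fun k => p`_k * b k) pn).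
rewrite big_mkcond; apply: eq_bigr => k _; case: ltnP => // pk.
by rewrite nth_default ?mul0r.
Qed.

Lemma coef_pair_is_linear b : linear_for *%R (coef_pair b).
Proof.
move=> a p q; pose n := maxn (size (a *: p + q)) (maxn (size p) (size q)).
rewrite !(@coef_pair_wide n) ?leq_max ?leqnn ?orbT// mulr_sumr -big_split/=.
by apply: eq_bigr => k _; rewrite coefD coefZ mulrDl mulrA.
Qed.

HB.instance Definition _ b :=
  GRing.isLinear.Build F {poly F} F *%R (coef_pair b) (@coef_pair_is_linear b).

Lemma coef_pairXn b n : coef_pair b 'X^n = b n.
Proof.
rewrite /coef_pair size_polyXn big_ord_recr/= big1 => [|k _].
  by rewrite coefXn eqxx mul1r add0r.
by rewrite coefXn ltn_eqF ?mul0r.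
Qed.

(** The action of p(T) on b, where T is the backward shift: this is the module
    structure dual to multiplication of polynomials. *)
Definition poly_act p b : nat -> F := fun l => coef_pair b (p * 'X^l).

Lemma poly_act_coefE p b l : poly_act p b l = \sum_(k < size p) p`_k * b (k + l)%N.
Proof.
rewrite /poly_act -{1}[p]coefK poly_def mulr_suml linear_sum; apply: eq_bigr => k _.
by rewrite -scalerAl -exprD linearZ/= coef_pairXn.
Qed.

Lemma coef_pair_poly_act p q b : coef_pair (poly_act p b) q = coef_pair b (p * q).
Proof.
rewrite -[in RHS](coefK q) poly_def mulr_sumr linear_sum; apply: eq_bigr => k _.
by rewrite -scalerAr linearZ.
Qed.

Lemma poly_actM p q b : poly_act (p * q) b = poly_act q (poly_act p b).
Proof. by apply/funext => l; rewrite {2}/poly_act coef_pair_poly_act mulrA. Qed.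

Lemma poly_act1 b : poly_act 1 b = b.
Proof. by apply/funext => l; rewrite /poly_act mul1r coef_pairXn. Qed.

Lemma poly_actD p q b : poly_act (p + q) b = fun l => poly_act p b l + poly_act q b l.
Proof. by apply/funext => l; rewrite /poly_act mulrDl linearD. Qed.

Lemma coef_pair_sum (I : Type) (s : seq I) (a : I -> F) (b : I -> nat -> F) p :
  coef_pair (fun l => \sum_(i <- s) a i * b i l) p =
  \sum_(i <- s) a i * coef_pair (b i) p.
Proof.
rewrite /coef_pair; under [RHS]eq_bigr do rewrite mulr_sumr.
rewrite exchange_big/=; apply: eq_bigr => k _; rewrite mulr_sumr.
by apply: eq_bigr => i _; rewrite mulrCA.
Qed.

Lemma coef_pairB x y p :
  coef_pair (fun l => x l - y l) p = coef_pair x p - coef_pair y p.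
Proof. by rewrite /coef_pair -sumrB; apply: eq_bigr => k _; rewrite mulrBr. Qed.

Lemma poly_actB p x y :
  poly_act p (fun l => x l - y l) = fun l => poly_act p x l - poly_act p y l.
Proof. by apply/funext => l; exact: coef_pairB. Qed.

Lemma poly_act_XsubC c b : poly_act ('X - c%:P) b = fun l => b l.+1 - c * b l.
Proof.
apply/funext => l.
by rewrite /poly_act mulrBl -exprS linearB/= mul_polyC linearZ/= !coef_pairXn.
Qed.

Lemma poly_act0 p : poly_act p (fun=> 0) = fun=> 0.
Proof. by apply/funext => l; rewrite poly_act_coefE big1// => k _; rewrite mulr0. Qed.

(** The j-th derivative of c^l with respect to c, so that pairing it with a
    polynomial yields the value of the j-th derivative at c. *)
Definition expmono (j : nat) c : nat -> F := fun l => (l ^_ j)%:R * c ^+ (l - j).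

(** This is the relation (T - c) c^l = 0 differentiated j+1 times with respect to
    c. *)
Lemma shift_expmonoS j c :
  poly_act ('X - c%:P) (expmono j.+1 c) = fun l => j.+1%:R * expmono j c l.
Proof.
rewrite poly_act_XsubC /expmono; apply/funext => l; rewrite subSS ffactSS ffactnSr.
have [lj|jl|->] := ltngtP l j.
- by rewrite ffact_small// !(muln0, mul0n, mul0r, mulr0, subr0).
- rewrite [c * _]mulrCA -exprS subnSK// -mulrBl mulrA; congr (_ * _).
  rewrite !natrM mulrC -mulrBr mulrC; congr (_ * _).
  have -> : l.+1 = (j.+1 + (l - j))%N by rewrite addSn subnKC// ltnW.
  by rewrite natrD addrK.
- by rewrite subnn muln0 mul0r mulr0 subr0 natrM mulrA.
Qed.

Lemma shift_expmono0 c : poly_act ('X - c%:P) (expmono 0 c) = fun=> 0.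
Proof.
rewrite poly_act_XsubC; apply/funext => l.
by rewrite /expmono !ffactn0 !subn0 !mul1r exprS subrr.
Qed.

Lemma poly_actZ p a b : poly_act p (fun l => a * b l) = fun l => a * poly_act p b l.
Proof.
apply/funext => l; rewrite !poly_act_coefE mulr_sumr.
by apply: eq_bigr => k _; rewrite mulrCA.
Qed.

Lemma poly_act_expmono_fact j c :
  poly_act (('X - c%:P) ^+ j) (expmono j c) = fun l => j`!%:R * expmono 0 c l.
Proof.
elim: j => [|j IH]; first by apply/funext=> l; rewrite expr0 poly_act1 mul1r.
rewrite exprS poly_actM shift_expmonoS poly_actZ IH; apply/funext => l.
by rewrite factS natrM mulrA.
Qed.

Lemma poly_act_expmono_eq0 j m c : (j < m)%N ->
  poly_act (('X - c%:P) ^+ m) (expmono j c) = fun=> 0.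
Proof.
move=> /subnKC <-; rewrite exprD exprSr !poly_actM poly_act_expmono_fact.
rewrite poly_actZ shift_expmono0.
by under eq_fun do rewrite mulr0; rewrite poly_act0.
Qed.

Lemma coef_pair_expmono_eq0 j c p :
  ('X - c%:P) ^+ j.+1 %| p -> coef_pair (expmono j c) p = 0.
Proof.
move=> /dvdpP[q ->]; rewrite mulrC -coef_pair_poly_act poly_act_expmono_eq0//.
by rewrite /coef_pair big1// => k _; rewrite mulr0.
Qed.

Lemma coef_pair_expmono0 c q : coef_pair (expmono 0 c) q = q.[c].
Proof.
rewrite /coef_pair horner_coef; apply: eq_bigr => k _.
by rewrite /expmono ffactn0 subn0 mul1r.
Qed.

(** Pairing with (X - beta_i)^j * prod_(i' <> i) (X - beta_i')^N kills the terms
    at the other points and those of order below j at beta_i, and leaves j! times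
    a nonzero value at order j; the coefficients at beta_i thus vanish from the
    highest order downwards. *)
Lemma expmono_free (I : finType) (beta : I -> F) N (d : I -> nat -> F) :
  injective beta ->
  (forall l, \sum_i \sum_(j < N) d i j * expmono j (beta i) l = 0) ->
  forall i j, (j < N)%N -> d i j = 0.
Proof.
move=> binj d0 i.
suff H t j : (j < N)%N -> (N - j <= t)%N -> d i j = 0.
  by move=> j jN; exact: (H N j jN (leq_subr _ _)).
elim: t j => [|t IH] j jN; first by rewrite leqn0 subn_eq0 leqNgt jN.
move=> Njt; pose q := \prod_(i' | i' != i) ('X - (beta i')%:P) ^+ N.
have q0 : q.[beta i] != 0.
  rewrite horner_prod prodf_seq_neq0; apply/allP => i' _; apply/implyP => i'i.
  by rewrite horner_exp hornerXsubC expf_neq0// subr_eq0 inj_eq// eq_sym.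
pose p := ('X - (beta i)%:P) ^+ j * q.
have : coef_pair (fun l =>
    \sum_i' 1 * \sum_(j' < N) d i' j' * expmono j' (beta i') l) p = 0.
  rewrite /coef_pair big1// => k _.
  by under eq_bigr do rewrite mul1r; rewrite d0 mulr0.
rewrite coef_pair_sum; under eq_bigr do rewrite mul1r coef_pair_sum.
rewrite (bigD1 i)//= [X in _ + X]big1 ?addr0; last first.
  move=> i' i'i; rewrite big1// => j' _.
  rewrite coef_pair_expmono_eq0 ?mulr0// /p /q (bigD1 i')//=.
  by rewrite mulrCA dvdp_mulr// dvdp_exp2l.
rewrite (bigD1 (Ordinal jN))//= big1 ?addr0.
  rewrite /p -coef_pair_poly_act poly_act_expmono_fact.
  have -> : coef_pair (fun l => j`!%:R * expmono 0 (beta i) l) q =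
    j`!%:R * q.[beta i].
    rewrite -coef_pair_expmono0 /coef_pair mulr_sumr.
    by apply: eq_bigr => k _; rewrite mulrCA.
  move/eqP; rewrite mulf_eq0 => /orP[/eqP//|].
  by rewrite mulf_eq0 (negbTE q0) orbF pnatr_eq0 gtn_eqF// fact_gt0.
move=> j' j'j; have [j'ltj|jltj'|j'E] := ltngtP j' j; last first.
- by rewrite -val_eqE/= j'E eqxx in j'j.
- rewrite IH ?mul0r//.
  by rewrite -ltnS (leq_trans _ Njt)// ltn_sub2l.
- by rewrite coef_pair_expmono_eq0 ?mulr0// /p dvdp_mulr// dvdp_exp2l.
Qed.

Lemma poly_act_sum (I : Type) (s : seq I) (a : I -> F) (b : I -> nat -> F) p :
  poly_act p (fun l => \sum_(i <- s) a i * b i l) =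
  fun l => \sum_(i <- s) a i * poly_act p (b i) l.
Proof. by apply/funext => l; exact: coef_pair_sum. Qed.

Definition lincomb_stable (S : (nat -> F) -> Prop) : Prop :=
  S (fun=> 0) /\ forall a x y, S x -> S y -> S (fun l => a * x l + y l).

Lemma lincomb_stableZ S a x : lincomb_stable S -> S x -> S (fun l => a * x l).
Proof.
move=> [S0 SD] Sx; have := SD a _ _ Sx S0.
by under eq_fun do rewrite addr0.
Qed.

Lemma lincomb_stable_sum S (I : eqType) (s : seq I) (a : I -> F) (b : I -> nat -> F) :
  lincomb_stable S -> {in s, forall i, S (b i)} ->
  S (fun l => \sum_(i <- s) a i * b i l).
Proof.
move=> [S0 SD]; elim: s => [_|i s IH sb].
  by under eq_fun do rewrite big_nil.
under eq_fun do rewrite big_cons.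
apply: SD; first by apply: sb; rewrite mem_head.
by apply: IH => j js; apply: sb; rewrite in_cons js orbT.
Qed.

Definition shift_stable (S : (nat -> F) -> Prop) : Prop :=
  lincomb_stable S /\ forall x, S x -> S (fun l => x l.+1).

Lemma shift_stable_poly_act S p b : shift_stable S -> S b -> S (poly_act p b).
Proof.
move=> Ss Sb; have Sk k : S (fun l => b (k + l)%N).
  elim: k => // k; case: Ss => _ ST /ST.
  by under eq_fun do rewrite addnS.
have -> : poly_act p b = fun l => \sum_(k <- index_iota 0 (size p)) p`_k * b (k + l)%N.
  by apply/funext => l; rewrite poly_act_coefE big_mkord.
by apply: lincomb_stable_sum => //; case: Ss.
Qed.

(** Induction on m: integrating the expansion of (T - c) b term by term gives b
    up to a multiple of c^l.  The one new sequence, of top order k, is obtained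
    from b and the lower ones, which are already in S, by dividing by its
    coefficient; if that coefficient vanishes, the expansion stops before k. *)
Lemma recurrence_primary S c m b : shift_stable S -> S b ->
  poly_act (('X - c%:P) ^+ m) b = (fun=> 0) ->
  exists k (d : nat -> F), [/\ (k <= m)%N,
    forall j, (j < k)%N -> S (expmono j c)
    & b = fun l => \sum_(j < k) d j * expmono j c l].
Proof.
move=> Ss; elim: m b => [|m IH] b Sb.
  rewrite expr0 poly_act1 => ->; exists 0%N, (fun=> 0); split=> //.
  by apply/funext => l; rewrite big_ord0.
rewrite exprS poly_actM => /(IH _ (shift_stable_poly_act _ _ _ Ss Sb))[k [d [km Sk bE]]].
(* Term j of (T - c) b comes from term j.+1 of b; b 0 fixes the constant term. *)
pose d' j := if j is j'.+1 then d j' / j%:R else b 0%N.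
have b'E : b = fun l => \sum_(j < k.+1) d' j * expmono j c l.
  pose e l := \sum_(j < k.+1) d' j * expmono j c l.
  have gS l : b l.+1 - e l.+1 = c * (b l - e l).
    apply/eqP; rewrite -subr_eq0; apply/eqP.
    have := poly_act_XsubC c (fun l => b l - e l); rewrite poly_actB bE poly_act_sum.
    move=> /(congr1 (@^~ l))/= <-; rewrite big_ord_recl shift_expmono0 mulr0 add0r.
    apply/eqP; rewrite subr_eq0; apply/eqP; apply: eq_bigr => j _.
    by rewrite /= shift_expmonoS mulrA divfK ?pnatr_eq0.
  have e0 : e 0%N = b 0%N.
    rewrite /e big_ord_recl big1/= => [|j _]; last first.
      by rewrite /expmono ffact0n mul0r mulr0.
    by rewrite /expmono ffactn0 expr0 !mulr1 addr0.
  apply/funext => l; apply/eqP; rewrite -subr_eq0; apply/eqP.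
  rewrite -/(e l); elim: l => [|l IHl]; first by rewrite e0 subrr.
  by rewrite gS IHl mulr0.
have [d'k|d'k] := eqVneq (d' k) 0.
  exists k, d'; split=> //; first exact: leqW.
  by rewrite {1}b'E; apply/funext => l; rewrite big_ord_recr/= d'k mul0r addr0.
exists k.+1, d'; split=> // j; rewrite ltnS leq_eqVlt => /predU1P[->|]; last exact: Sk.
have -> : expmono k c =
    fun l => (d' k)^-1 * (-1 * (\sum_(j < k) d' j * expmono j c l) + b l).
  apply/funext => l; rewrite {1}b'E big_ord_recr/= mulN1r addKr.
  by rewrite mulKf.
case: (Ss) => Sl _; apply: lincomb_stableZ => //; case: (Sl) => _ SD; apply: SD => //.
by apply: lincomb_stable_sum => // i _; exact: Sk.
Qed.

(** The two parts are the images of b under the two terms of a Bezout relation,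
    hence stay in any space stable under linear combinations and the shift. *)
Lemma recurrence_split S p q b : shift_stable S -> S b -> coprimep p q ->
  poly_act (p * q) b = (fun=> 0) ->
  exists x y, [/\ S x, S y, poly_act p x = (fun=> 0), poly_act q y = (fun=> 0)
    & b = fun l => x l + y l].
Proof.
move=> Ss Sb /Bezout_eq1_coprimepP[[u v] /= uv1] pqb.
exists (poly_act (v * q) b), (poly_act (u * p) b); split.
- exact: shift_stable_poly_act.
- exact: shift_stable_poly_act.
- by rewrite -poly_actM -mulrA [q * p]mulrC [v * _]mulrC poly_actM pqb poly_act0.
- by rewrite -poly_actM -mulrA [u * _]mulrC poly_actM pqb poly_act0.
- by rewrite -poly_actD addrC uv1 poly_act1.
Qed.

(** Primary decomposition carried out inside S: the polynomials in T that project
    onto the primary components preserve S. *)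
Lemma recurrence_solution S (s : seq F) (m : F -> nat) b :
  shift_stable S -> S b -> uniq s ->
  poly_act (\prod_(c <- s) ('X - c%:P) ^+ m c) b = (fun=> 0) ->
  exists (k : F -> nat) (d : F -> nat -> F),
    (forall c, c \in s -> (k c <= m c)%N /\
       forall j, (j < k c)%N -> S (expmono j c)) /\
    b = fun l => \sum_(c <- s) \sum_(j < k c) d c j * expmono j c l.
Proof.
move=> Ss; elim: s b => [|c s IH] b Sb.
  rewrite big_nil poly_act1 => _ ->; exists (fun=> 0%N), (fun=> fun=> 0); split=> //.
  by apply/funext => l; rewrite big_nil.
move=> /= /andP[cs us]; rewrite big_cons => /(recurrence_split _ _ _ _ Ss Sb).
case.
  apply: coprimep_expl; rewrite coprimep_sym coprimep_XsubC.
  rewrite /root horner_prod prodf_seq_neq0; apply/allP => z zs; apply/implyP => _.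
  rewrite horner_exp hornerXsubC expf_neq0// subr_eq0.
  by apply: contraNneq cs => ->.
move=> x [y [Sx Sy /(recurrence_primary _ _ _ _ Ss Sx)[k0 [d0 [k0m Sk0 xE]]]]].
move=> /(IH _ Sy us)[k [d [kd yE]]] ->.
exists (fun z => if z == c then k0 else k z), (fun z => if z == c then d0 else d z).
split.
  move=> z; rewrite in_cons; case: eqP => [-> _|_ /=]; first by split.
  exact: kd.
apply/funext => l; rewrite big_cons eqxx xE yE; congr (_ + _).
rewrite !big_seq; apply: eq_bigr => z zs.
by rewrite (_ : (z == c) = false)//; apply: contraNF cs => /eqP <-.
Qed.

End LinearRecurrences.

(** * Absolutely convergent complex series *)

Lemma cvg_series_lincomb (K : numFieldType) (a b : K) (u v : nat -> K^o) :
  cvgn (series u) -> cvgn (series v) ->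
  series (fun n => a * u n + b * v n : K^o) @ \oo -->
    (a * limn (series u) + b * limn (series v) : K^o).
Proof.
move=> cu cv; have -> : series (fun n => a * u n + b * v n : K^o) =
    (fun n => a *: (series u n) + b *: series v n).
  by apply/funext => n; rewrite /series/= big_split/= -!mulr_sumr.
exact: cvgD (cvgZl_tmp cu) (cvgZl_tmp cv).
Qed.

Section ComplexSeries.
Context {R : realType}.
Implicit Types (u v : nat -> R[i]) (a l z : R[i]).

Lemma normC_normc z : `|z| = (normc z)%:C. Proof. by []. Qed.

Lemma normc_ge0 z : 0 <= normc z.
Proof. by case: z => x y; exact: sqrtr_ge0. Qed.

Lemma normcD_le (x y : R[i]) : normc (x + y) <= normc x + normc y.
Proof. by rewrite -lecR rmorphD/= -!normC_normc ler_normD. Qed.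

Lemma normc_conj z : normc (Num.conj z) = normc z.
Proof. by apply: complexI; rewrite -!normC_normc norm_conjC. Qed.

Lemma normc_real (x : R) : normc x%:C = `|x|.
Proof. by rewrite /= expr0n addr0 sqrtr_sqr. Qed.

Lemma normc_ReIm z : `|Re z| <= normc z /\ `|Im z| <= normc z.
Proof.
case: z => x y /=; rewrite -!sqrtr_sqr; split; rewrite ler_wsqrtr//.
  by rewrite lerDl sqr_ge0.
by rewrite lerDr sqr_ge0.
Qed.

Lemma normc_le_ReIm z : normc z <= `|Re z| + `|Im z|.
Proof.
rewrite {1}[z]complexE (le_trans (normcD_le _ _))// normc_real lerD2l.
by rewrite ComplexField.Normc.normcM normc_real /= expr0n/= expr1n add0r sqrtr1 mul1r.
Qed.

(** The topology of R[i]^o is stated with complex-valued radii; this brings it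
    back to real ones. *)
Lemma cvg_normcP u l :
  (u : nat -> R[i]^o) @ \oo --> (l : R[i]^o) <->
  forall e : R, 0 < e -> \forall n \near \oo, normc (l - u n) < e.
Proof.
split=> [/cvgrPdist_lt H e e0|H].
  have : 0 < e%:C :> R[i] by rewrite ltcR.
  move=> /H; apply: filterS => n; rewrite -ltcR; exact.
apply/cvgrPdist_lt => e; rewrite ltcE => /andP[/eqP/= Ime Ree].
have eE : e = (Re e)%:C by case: e Ime {Ree} => x y /= ->.
by apply: filterS (H _ Ree) => n; rewrite eE -ltcR; exact.
Qed.

(** Completeness of the reals is applied to the real and imaginary parts. *)
Lemma abs_cvg_series u : cvgn (series (fun n => normc (u n))) ->
  cvgn (series u : nat -> R[i]^o) /\
  normc (limn (series u : nat -> R[i]^o)) <= limn (series (fun n => normc (u n))).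
Proof.
move=> cu.
have part (p : R[i] -> R) : (forall z, `|p z| <= normc z) ->
    cvgn (series (fun n => p (u n))).
  move=> pu; apply: normed_cvg; apply: series_le_cvg cu => n //=.
  exact: normc_ge0.
have cR : cvgn (series (fun n => Re (u n))) by apply: part => z; case: (normc_ReIm z).
have cI : cvgn (series (fun n => Im (u n))) by apply: part => z; case: (normc_ReIm z).
pose l := limn (series (fun n => Re (u n))) +i* limn (series (fun n => Im (u n))).
have ul : (series u : nat -> R[i]^o) @ \oo --> (l : R[i]^o).
  apply/cvg_normcP => e e0; have e20 : 0 < e / 2 by rewrite divr_gt0.
  move/cvgrPdist_lt : cR => /(_ _ e20) cR; move/cvgrPdist_lt : cI => /(_ _ e20) cI.
  near=> n.
  have sE : series u n = series (fun n => Re (u n)) n +i* series (fun n => Im (u n)) n.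
    rewrite /series/=; elim: (index_iota 0 n) => [|k s IH]; first by rewrite !big_nil.
    by rewrite !big_cons IH; case: (u k).
  rewrite (le_lt_trans (normc_le_ReIm _))// sE [ltRHS](splitr e) ltrD//=.
    by near: n.
  by near: n.
split; first by apply/cvg_ex; exists l.
have -> : limn (series u : nat -> R[i]^o) = l.
  by apply: cvg_lim => //; exact: norm_hausdorff.
apply/ler_addgt0Pr => e e0.
move/cvg_normcP : ul => /(_ _ e0) [N _ /(_ N (leqnn N))] lN.
rewrite -[l](subrK (series u N)) [leRHS]addrC (le_trans (normcD_le _ _))//.
apply: lerD; first exact: ltW.
apply: (@le_trans _ _ (series (fun n => normc (u n)) N)).
  rewrite /series/=; elim: (index_iota 0 N) => [|k s IH].
    by rewrite !big_nil ComplexField.Normc.normc0.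
  by rewrite !big_cons (le_trans (normcD_le _ _))// lerD2l.
apply: nondecreasing_cvgn_le => // m n mn.
rewrite /series/= (big_cat_nat (n := m) (p := n))//= lerDl sumr_ge0// => k _.
exact: normc_ge0.
Unshelve. all: by end_near.
Qed.

End ComplexSeries.

(** * The dual weighted space and reproducibility *)

Section Duality.
Context {R : realType} {w : nat -> R}.
Hypothesis w_gt0 : forall l, 0 < w l.
Implicit Types (h x y e : nat -> R[i]).

Let winv l := (w l)^-1.

Lemma lincomb_stable_H2w (v : nat -> R) :
  (forall l, 0 < v l) -> lincomb_stable (H2w v).
Proof.
move=> v0; split=> [|a x y Hx Hy]; first by apply: (@H2w_finite _ _ _ 0%N).
have /(cvgP _) := cvg_series_lincomb _ (2 * normc a ^+ 2) 2 _ _ Hx Hy.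
have nn (z : R[i]) l : 0 <= v l * normc z ^+ 2 by rewrite mulr_ge0 ?sqr_ge0 ?ltW.
apply: series_le_cvg => l //=.
  by apply: addr_ge0; rewrite mulr_ge0// mulr_ge0// sqr_ge0.
have := normcD_le (a * x l) (y l); rewrite ComplexField.Normc.normcM => le1.
rewrite [2 * _ * (_ * _)]mulrCA [2 * (v l * _)]mulrCA -mulrDr ler_pM2l//.
apply: (@le_trans _ _ ((normc a * normc (x l) + normc (y l)) ^+ 2)).
  by rewrite ler_sqr ?nnegrE// ?addr_ge0 ?mulr_ge0 ?normc_ge0.
move: (normc a) (normc (x l)) (normc (y l)) => A X Y.
have := sqr_ge0 (A * X - Y); rewrite !expr2; nra.
Qed.

(** If w_(l+1) <= M w_l then 1/w_l <= M/w_(l+1), so the backward shift multiplies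
    the squared norm of weight 1/w by at most M. *)
Lemma shift_stable_dual :
  (fun l => w l.+1 / w l) @ \oo --> (1 : R) -> shift_stable (H2w winv).
Proof.
move=> w1; split; first by apply: lincomb_stable_H2w => l; rewrite invr_gt0.
move=> x Hx.
have /cvg_seq_bounded/pinfty_ex_gt0[M M0 /= HM] : cvgn (fun l => w l.+1 / w l).
  by apply/cvg_ex; exists 1.
have Hx' : cvgn (series (fun l => winv l.+1 * normc (x l.+1) ^+ 2)).
  have : cvgn [sequence \sum_(1 <= k < n) (winv k * normc (x k) ^+ 2)]_n.
    by rewrite is_cvg_series_restrict.
  move=> /cvg_ex[l]; rewrite -cvg_shiftS => sl; apply/cvg_ex; exists l.
  suff -> : series (fun l => winv l.+1 * normc (x l.+1) ^+ 2) =
    (fun n => \sum_(1 <= k < n.+1) (winv k * normc (x k) ^+ 2)) by [].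
  by apply/funext => n; rewrite big_add1.
have /(cvgP _) := cvg_series_lincomb _ M 0 _ _ Hx' Hx'.
apply: series_le_cvg => l /=.
- by rewrite mulr_ge0 ?sqr_ge0 ?invr_ge0 ?ltW.
- rewrite mul0r addr0.
  by rewrite mulr_ge0 ?(ltW M0)// mulr_ge0 ?sqr_ge0 ?invr_ge0 ?ltW.
- rewrite mul0r addr0 [leRHS]mulrA; apply: ler_wpM2r; first exact: sqr_ge0.
  by rewrite ler_pdivlMr// mulrC (le_trans (ler_norm _))// HM.
Qed.

(** The Riesz representation: it identifies H^2_w antilinearly with the sequence
    space of weight 1/w, acting on H^2_w through the unweighted pairing below.
    The kernel for j-th derivatives at beta becomes expmono j beta. *)
Definition dualize x : nat -> R[i] := fun l => (w l)%:C * Num.conj (x l).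

Definition dual_pair x e : R[i] := limn (series (fun l => x l * e l) : nat -> R[i]^o).

Lemma dual_pair_finite N x e : (forall l, (N <= l)%N -> x l * e l = 0) ->
  dual_pair x e = \sum_(l < N) x l * e l.
Proof. by move=> xe0; rewrite /dual_pair (lim_series_finite xe0) /series/= big_mkord. Qed.

Lemma innerw_dual_pair x y : innerw w x y = dual_pair x (dualize y).
Proof.
rewrite /innerw /dual_pair; suff -> : (fun l => (w l)%:C * x l * Num.conj (y l)) =
  (fun l => x l * dualize y l) by [].
by apply/funext => l; rewrite /dualize /winv mulrCA mulrA.
Qed.

Lemma deriv_at_dual_pair m beta h : deriv_at m beta h = dual_pair h (expmono m beta).
Proof.
rewrite /deriv_at /dual_pair; suff -> : dterm m beta h =
  (fun l => h l * expmono m beta l) by [].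
by apply/funext => l; rewrite /dterm /expmono mulrCA mulrA.
Qed.

Lemma H2w_dualize x : H2w winv (dualize x) = H2w w x.
Proof.
rewrite /H2w/=; suff -> : (fun l => winv l * normc (dualize x l) ^+ 2) =
  (fun l => w l * normc (x l) ^+ 2) by [].
apply/funext => l; rewrite /dualize /winv ComplexField.Normc.normcM normc_conj.
rewrite normc_real exprMn gtr0_norm//.
by rewrite [w l ^+ 2]expr2 -!mulrA mulKf ?gt_eqF.
Qed.

Lemma dualize_kernel m beta :
  Omega w m beta -> dualize (rep_kernel w m beta) = expmono m beta.
Proof.
move=> O; rewrite rep_kernelE//; apply/funext => l.
by have := kernel_coefE w_gt0 m beta l 1; rewrite !mulr1.
Qed.

Lemma normw_ge0 (v : nat -> R) h : 0 <= normw v h.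
Proof. exact: sqrtr_ge0. Qed.

Lemma normw_eq0 h : H2w w h -> normw w h = 0 -> h = fun=> 0.
Proof.
move=> Hh /eqP; rewrite sqrtr_eq0 => n0; apply/funext => l.
have t0 k : 0 <= w k * normc (h k) ^+ 2 by rewrite mulr_ge0 ?sqr_ge0 ?ltW.
have nd : nondecreasing_seq (series (fun k => w k * normc (h k) ^+ 2)).
  move=> m n mn; rewrite /series/= (big_cat_nat (n := m) (p := n))//= lerDl.
  by rewrite sumr_ge0.
have /le_trans/(_ n0) := nondecreasing_cvgn_le nd Hh l.+1.
rewrite /series/= big_nat_recr//= => le0.
have : w l * normc (h l) ^+ 2 <= 0.
  by apply: le_trans le0; rewrite lerDr sumr_ge0.
rewrite pmulr_rle0// => le1.
have /eqP := le_anti (introT andP (conj le1 (sqr_ge0 _))).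
by rewrite sqrf_eq0 => /eqP/ComplexField.Normc.eq0_normc.
Qed.

Lemma sqr_normw (v : nat -> R) h : (forall l, 0 < v l) -> H2w v h ->
  normw v h ^+ 2 = limn (series (fun l => v l * normc (h l) ^+ 2)).
Proof.
move=> v0 Hh; rewrite sqr_sqrtr//; apply: limr_ge => //; apply: nearW => n.
by apply: sumr_ge0 => k _; rewrite mulr_ge0 ?sqr_ge0 ?ltW.
Qed.

(** The free parameter n makes this form of the arithmetic-geometric inequality
    as good as Cauchy-Schwarz: taking n to be the norm of h gives a bound linear
    in that norm. *)
Lemma dual_pair_cvg_bound h e (n : R) : H2w w h -> H2w winv e -> 0 < n ->
  cvgn (series (fun l => h l * e l) : nat -> R[i]^o) /\
  normc (dual_pair h e) <= (2 * n)^-1 * normw w h ^+ 2 + n / 2 * normw winv e ^+ 2.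
Proof.
move=> Hh He n0.
have winv0 l : 0 < winv l by rewrite invr_gt0.
have cb := cvg_series_lincomb _ (2 * n)^-1 (n / 2) _ _ Hh He.
have le1 l : normc (h l * e l) <=
    (2 * n)^-1 * (w l * normc (h l) ^+ 2) + n / 2 * (winv l * normc (e l) ^+ 2).
  rewrite ComplexField.Normc.normcM -subr_ge0 /winv.
  set X := normc _; set Y := normc _; have w0 := w_gt0 l.
  have -> : (2 * n)^-1 * (w l * X ^+ 2) + n / 2 * ((w l)^-1 * Y ^+ 2) - X * Y =
      (w l * X - n * Y) ^+ 2 / (2 * n * w l).
    by field; rewrite !gt_eqF.
  by rewrite divr_ge0 ?sqr_ge0// !mulr_ge0// ltW.
have ca : cvgn (series (fun l => normc (h l * e l))).
  apply: series_le_cvg (cvgP _ cb) => // l; first exact: normc_ge0.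
  exact: le_trans (normc_ge0 _) (le1 _).
have [cs le2] := abs_cvg_series _ ca; split=> //.
rewrite (le_trans le2)// (le_trans (lim_series_le ca (cvgP _ cb) le1))//.
by rewrite !sqr_normw// (cvg_lim _ cb).
Qed.

Lemma dual_pair_cvg h e : H2w w h -> H2w winv e ->
  cvgn (series (fun l => h l * e l) : nat -> R[i]^o).
Proof. by move=> Hh He; case: (dual_pair_cvg_bound _ _ 1 Hh He ltr01). Qed.

Lemma reproducible_dual m beta : H2w winv (expmono m beta) -> reproducible w m beta.
Proof.
move=> He; split=> [h Hh|].
  have -> : dterm m beta h = (fun l => h l * expmono m beta l).
    by apply/funext => l; rewrite /dterm /expmono mulrCA mulrA.
  exact: dual_pair_cvg.
exists ((1 + normw winv (expmono m beta) ^+ 2) / 2) => h Hh; rewrite deriv_at_dual_pair.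
have [n0|n0] := eqVneq (normw w h) 0.
  rewrite n0 mulr0 (normw_eq0 _ Hh n0) (dual_pair_finite 0) => [|l _].
    by rewrite big_ord0 ComplexField.Normc.normc0.
  by rewrite mul0r.
have np : 0 < normw w h by rewrite lt_def n0 normw_ge0.
have [_ le1] := dual_pair_cvg_bound _ _ _ Hh He np.
apply: (le_trans le1); rewrite le_eqVlt; apply/orP; left; apply/eqP.
by field; rewrite gt_eqF.
Qed.

Lemma dual_pairDl a x y e : H2w w x -> H2w w y -> H2w winv e ->
  dual_pair (fun l => a * x l + y l) e = a * dual_pair x e + dual_pair y e.
Proof.
move=> Hx Hy He; rewrite {1}/dual_pair.
apply: (@cvg_lim R[i]^o); first exact: norm_hausdorff.
have -> : (fun l => (a * x l + y l) * e l) =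
    (fun l => a * (x l * e l) + 1 * (y l * e l)).
  by apply/funext => l; rewrite mulrDl mulrA mul1r.
rewrite -[dual_pair y e]mul1r.
by apply: cvg_series_lincomb; exact: dual_pair_cvg.
Qed.

Lemma dual_pairDr h a x y : H2w w h -> H2w winv x -> H2w winv y ->
  dual_pair h (fun l => a * x l + y l) = a * dual_pair h x + dual_pair h y.
Proof.
move=> Hh Hx Hy; rewrite {1}/dual_pair.
apply: (@cvg_lim R[i]^o); first exact: norm_hausdorff.
have -> : (fun l => h l * (a * x l + y l)) =
    (fun l => a * (h l * x l) + 1 * (h l * y l)).
  by apply/funext => l; rewrite mulrDr mulrCA mul1r.
rewrite -[dual_pair h y]mul1r.
by apply: cvg_series_lincomb; exact: dual_pair_cvg.
Qed.

Lemma dual_pair_sumr h (I : eqType) (s : seq I) (a : I -> R[i])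
    (e : I -> nat -> R[i]) :
  H2w w h -> {in s, forall i, H2w winv (e i)} ->
  dual_pair h (fun l => \sum_(i <- s) a i * e i l) =
  \sum_(i <- s) a i * dual_pair h (e i).
Proof.
move=> Hh; elim: s => [|i s IH] He.
  rewrite big_nil (dual_pair_finite 0) ?big_ord0// => l _.
  by rewrite big_nil mulr0.
rewrite big_cons -IH; last by move=> j js; apply: He; rewrite in_cons js orbT.
have winv0 l : 0 < winv l by rewrite invr_gt0.
under eq_fun do rewrite big_cons.
apply: dual_pairDr => //; first by apply: He; rewrite mem_head.
apply: lincomb_stable_sum; first exact: lincomb_stable_H2w.
by move=> j js; apply: He; rewrite in_cons js orbT.
Qed.

Lemma dual_pair_coef (p : {poly R[i]}) e : dual_pair (fun l => p`_l) e = coef_pair e p.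
Proof.
by rewrite (dual_pair_finite (size p))// => l pl; rewrite nth_default// mul0r.
Qed.

(** The pairing of x with its dual is the squared norm of x. *)
Lemma dual_pair_dualize_eq0 x : H2w w x -> dual_pair x (dualize x) = 0 -> x = fun=> 0.
Proof.
move=> Hx px; apply: normw_eq0 => //; apply/eqP; rewrite -sqrf_eq0 sqr_normw//.
apply/eqP; apply: complexI; transitivity (dual_pair x (dualize x)); last by rewrite px.
apply/esym/(@cvg_lim R[i]^o); first exact: norm_hausdorff.
apply/cvg_normcP => e e0; have /cvgrPdist_lt/(_ _ e0) := Hx.
apply: filterS => n; rewrite -normc_real rmorphB/= => le1.
suff -> : series (fun l => x l * dualize x l) n =
  (series (fun l => w l * normc (x l) ^+ 2) n)%:C by [].
rewrite /series/= rmorph_sum/=; apply: eq_bigr => l _.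
by rewrite /dualize mulrCA -sqr_normcE -rmorphM.
Qed.

End Duality.

(** * The invariant subspace generated by a polynomial *)

Lemma monic_prod_mup (K : closedFieldType) (p : {poly K}) : p \is monic ->
  exists s, [/\ uniq s, forall x, (x \in s) = root p x
    & p = \prod_(c <- s) ('X - c%:P) ^+ mup c p].
Proof.
move=> /monicP lp; have [s] := closed_field_poly_normal p; rewrite lp scale1r => ps.
exists (undup s); split; first exact: undup_uniq.
  by move=> x; rewrite mem_undup ps root_prod_XsubC.
rewrite ps -prodr_undup_exp_count; apply: eq_bigr => c _.
by rewrite prodr_undup_exp_count mu_prod_XsubC.
Qed.

Section Projection.
Context {R : realType} {w : nat -> R}.
Hypothesis w_gt0 : forall l, 0 < w l.
Implicit Types (f : {poly R[i]}) (x h p : nat -> R[i]).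

Let winv l := (w l)^-1.

Lemma mulzn_coef n f : mulzn n (fun l => f`_l) = fun l => (f * 'X^n)`_l.
Proof. by apply/funext => l; rewrite coefMXn. Qed.

Lemma H2w_poly f : H2w w (fun l => f`_l).
Proof. by apply: (@H2w_finite _ _ _ (size f)) => l; exact: nth_default. Qed.

Lemma mulzn_in_closure n f :
  invariant_closure w (fun l => f`_l) (mulzn n (fun l => f`_l)).
Proof.
split; first by rewrite mulzn_coef; exact: H2w_poly.
move=> e e0; exists (mulzn n (fun l => f`_l)).
  exists n.+1, (fun i => (i == ord_max)%:R); apply/funext => l.
  rewrite big_ord_recr/= eqxx mul1r big1 ?add0r// => i _.
  by rewrite -val_eqE/= ltn_eqF ?mul0r.
suff -> : normw w (fun l =>
    mulzn n (fun l => f`_l) l - mulzn n (fun l => f`_l) l) = 0.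
  by [].
rewrite /normw (@lim_series_finite _ _ 0%N) => [|l _].
  by rewrite /series/= big_geq// sqrtr0.
by rewrite subrr ComplexField.Normc.normc0 expr0n mulr0.
Qed.

(** The inner product of x with z^n f is the conjugate of the n-th entry of
    f(T) applied to the dual of x. *)
Lemma orth_recurrence f x : (forall n, innerw w x (mulzn n (fun l => f`_l)) = 0) ->
  poly_act f (dualize (w := w) x) = fun=> 0.
Proof.
move=> x0; apply/funext => n; have /(congr1 Num.conj) := x0 n.
rewrite mulzn_coef rmorph0 => <-.
rewrite innerw_dual_pair (dual_pair_finite (size (f * 'X^n))) => [|l sl]; last first.
  by rewrite /dualize nth_default// rmorph0 !mulr0.
rewrite rmorph_sum/=; apply: eq_bigr => l _; rewrite /dualize 2!rmorphM/= conjCK.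
by rewrite [Num.conj _%:C]conjc_real mulrC -mulrA mulrCA.
Qed.

Lemma shift_span_poly f p : shift_span (fun l => f`_l) p ->
  exists q, p = fun l => (f * q)`_l.
Proof.
move=> [N [c ->]]; exists (\sum_(n < N) c n *: 'X^n); apply/funext => l.
rewrite mulr_sumr coef_sum; apply: eq_bigr => n _.
by rewrite -scalerAr coefZ mulzn_coef.
Qed.

(** The functional vanishes on the multiples of f because beta is a zero of order
    greater than j, and on their closure because it is bounded. *)
Lemma deriv_at_closure f j beta h : Omega w j beta ->
  ('X - beta%:P) ^+ j.+1 %| f -> invariant_closure w (fun l => f`_l) h ->
  deriv_at j beta h = 0.
Proof.
move=> Om fdvd [Hh happ]; have [_ [M HM]] := Om.
have He : H2w winv (expmono j beta).
  by rewrite -(dualize_kernel w_gt0)// H2w_dualize//; case: (rep_kernelP w_gt0 Om).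
apply: ComplexField.Normc.eq0_normc; apply/eqP; rewrite eq_le normc_ge0 andbT.
apply/ler_addgt0Pr => e e0; rewrite add0r.
(* M may be negative or zero, hence the radius e / (`|M| + 1). *)
have M0 : 0 < `|M| + 1 by rewrite ltr_wpDl.
have [p /shift_span_poly[q ->] hp] := happ (e / (`|M| + 1)) (divr_gt0 e0 M0).
have [_ SD] := lincomb_stable_H2w _ w_gt0.
have HD : H2w w (fun l => h l - (f * q)`_l).
  have := SD (-1) _ _ (H2w_poly (f * q)) Hh.
  by under eq_fun do rewrite mulN1r addrC.
have -> : deriv_at j beta h = deriv_at j beta (fun l => h l - (f * q)`_l).
  rewrite !deriv_at_dual_pair.
  have -> : (fun l => h l - (f * q)`_l) = (fun l => -1 * (f * q)`_l + h l).
    by apply/funext => l; rewrite mulN1r addrC.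
  rewrite (dual_pairDl w_gt0) ?dual_pair_coef ?coef_pair_expmono_eq0 ?mulr0 ?add0r//.
    by rewrite dvdp_mulr.
  exact: H2w_poly.
rewrite (le_trans (HM _ HD))// (le_trans (ler_wpM2r (normw_ge0 _ _) (ler_norm M)))//.
rewrite (le_trans (ler_wpM2l _ (ltW hp)))// mulrCA ler_piMr ?ltW//.
by rewrite ltr_pdivrMr// mul1r ltrDl.
Qed.

End Projection.

(** * Combinations of reproducing kernels at the zeros *)

Section ZeroKernels.
Context {R : realType} {w : nat -> R}.
Hypothesis w_gt0 : forall l, 0 < w l.
Context {r : nat} {beta : 'I_r -> R[i]} {mult : 'I_r -> nat}.
Hypothesis beta_inj : injective beta.
Implicit Types C D : 'I_r -> nat -> R[i].

Let winv l := (w l)^-1.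
Let Iset := Iset w beta mult.
Let N := (max_order w beta mult).+1.

Lemma mem_Iset i j : i \in Iset j <-> Omega w j (beta i) /\ (j < mult i)%N.
Proof.
rewrite /Iset inE; split=> [/asboolP[i' [/beta_inj <- Om ji]]|[Om ji]]; first by [].
by apply/asboolP; exists i.
Qed.

Lemma Iset_max_order i j : i \in Iset j -> (j < N)%N.
Proof.
move=> /mem_Iset[Om ji]; rewrite ltnS.
by case: (@max_orderP _ w _ beta mult j) => //; exists (beta i), i.
Qed.

(** Outside I_j the kernel need not exist; the value zero there allows sums over
    the full rectangle of indices without side conditions. *)
Definition zero_kernel (i : 'I_r) j : nat -> R[i] :=
  if i \in Iset j then rep_kernel w j (beta i) else fun=> 0.

(** The factors 1 give both levels of the double sum the form of a linear
    combination, to which the lemmas on finite sums apply twice. *)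
Lemma kernel_combE C : kernel_comb w beta mult C =
  fun l => one_coef R l + \sum_i 1 * \sum_(j < N) C i j * zero_kernel i j l.
Proof.
apply/funext => l; rewrite /kernel_comb; congr (_ + _).
under [RHS]eq_bigr do rewrite mul1r; rewrite [RHS]exchange_big/=.
apply: eq_bigr => j _; rewrite big_mkcond; apply: eq_bigr => i _.
by rewrite /zero_kernel; case: ifP => // _; rewrite mulr0.
Qed.

Lemma H2w_one : H2w w (one_coef R).
Proof. by apply: (@H2w_finite _ _ _ 1%N) => -[]. Qed.

Lemma H2w_zero_kernel i j : H2w w (zero_kernel i j).
Proof.
rewrite /zero_kernel; case: ifPn => [/mem_Iset[Om _]|_].
  by case: (rep_kernelP w_gt0 Om).
by apply: (@H2w_finite _ _ _ 0%N).
Qed.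

Lemma H2w_kernel_comb C : H2w w (kernel_comb w beta mult C).
Proof.
have Sw := lincomb_stable_H2w _ w_gt0; have [_ SD] := Sw; rewrite kernel_combE.
under eq_fun do rewrite -[one_coef R _]mul1r.
apply: SD; first exact: H2w_one.
apply: lincomb_stable_sum => // i _; apply: lincomb_stable_sum => // j _.
exact: H2w_zero_kernel.
Qed.

Lemma dualize_zero_kernel i j :
  dualize (w := w) (zero_kernel i j) =
  if i \in Iset j then expmono j (beta i) else fun=> 0.
Proof.
rewrite /zero_kernel; case: ifPn => [/mem_Iset[Om _]|_]; first exact: dualize_kernel.
by apply/funext => l; rewrite /dualize rmorph0 mulr0.
Qed.

(** The difference d of the two combinations is orthogonal to each kernel and is
    itself a combination of kernels, so it is orthogonal to itself. *)
Lemma kernel_comb_unique C D :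
  (forall i j, i \in Iset j ->
    innerw w (kernel_comb w beta mult C) (rep_kernel w j (beta i)) = 0) ->
  (forall i j, i \in Iset j ->
    innerw w (kernel_comb w beta mult D) (rep_kernel w j (beta i)) = 0) ->
  forall i j, i \in Iset j -> D i j = C i j.
Proof.
move=> C0 D0.
pose d l := -1 * kernel_comb w beta mult C l + kernel_comb w beta mult D l.
have Hd : H2w w d.
  by have [_ SD] := lincomb_stable_H2w _ w_gt0; apply: SD; exact: H2w_kernel_comb.
have Hk i j : H2w winv (dualize (w := w) (zero_kernel i j)).
  by rewrite H2w_dualize//; exact: H2w_zero_kernel.
have d_perp i j : dual_pair d (dualize (w := w) (zero_kernel i j)) = 0.
  have [iI|iI] := boolP (i \in Iset j); last first.
    rewrite dualize_zero_kernel (negbTE iI) (dual_pair_finite 0) ?big_ord0// => l _.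
    by rewrite mulr0.
  rewrite (dual_pairDl w_gt0 _ _ _ _ (H2w_kernel_comb C) (H2w_kernel_comb D)
    (Hk i j)).
  rewrite /zero_kernel iI -!innerw_dual_pair.
  by rewrite C0// D0// mulr0 addr0.
have dE : dualize (w := w) d = fun l => \sum_i 1 * \sum_(j < N)
    Num.conj (D i j - C i j) * dualize (w := w) (zero_kernel i j) l.
  apply/funext => l; rewrite /d !kernel_combE /dualize mulN1r opprD addrACA addNr add0r.
  rewrite addrC -sumrB rmorph_sum mulr_sumr; apply: eq_bigr => i _.
  rewrite !mul1r -sumrB rmorph_sum mulr_sumr; apply: eq_bigr => j _.
  by rewrite -mulrBl rmorphM mulrCA.
have Sv : lincomb_stable (H2w winv).
  by apply: lincomb_stable_H2w => l; rewrite invr_gt0.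
have d0 : d = fun=> 0.
  apply: (dual_pair_dualize_eq0 w_gt0) => //.
  rewrite dE (dual_pair_sumr w_gt0)//; last first.
    by move=> i _; apply: lincomb_stable_sum.
  rewrite big1// => i _; rewrite (dual_pair_sumr w_gt0)// big1 ?mulr0// => j _.
  by rewrite d_perp mulr0.
move=> i j iI; apply/eqP; rewrite -subr_eq0 -conjC_eq0; apply/eqP.
pose e i' j' := if i' \in Iset j' then Num.conj (D i' j' - C i' j') else 0.
have -> : Num.conj (D i j - C i j) = e i j by rewrite /e iI.
apply: (@expmono_free _ _ beta N) => //; last exact: Iset_max_order iI.
move=> l; have /(congr1 (@^~ l)) := dE; rewrite d0 /dualize rmorph0 mulr0 => /esym.
under eq_bigr do rewrite mul1r.
move=> sum0; rewrite -[RHS]sum0; apply: eq_bigr => i' _; apply: eq_bigr => j' _.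
rewrite -/(dualize (w := w) (zero_kernel i' j') l) dualize_zero_kernel /e.
case: ifP => // _.
by rewrite mul0r mulr0.
Qed.

End ZeroKernels.

Theorem theorem5p4 (R : realType) (w : nat -> R)
  (w_gt0 : forall l : nat, 0 < w l) (w_0 : w 0%N = 1)
  (w_ratio : (fun l : nat => w l.+1 / w l) @ \oo --> (1 : R))
  (f : {poly R[i]}) (f_monic : f \is monic) (f_0 : f.[0] != 0)
  (r : nat) (beta : 'I_r -> R[i]) (mult : 'I_r -> nat)
  (beta_inj : injective beta)
  (beta_roots : forall x : R[i], root f x <-> exists i : 'I_r, x = beta i)
  (mult_eq : forall i : 'I_r, mult i = mup (beta i) f)
  (phi : nat -> R[i])
  (phi_proj :
     is_orth_proj w (invariant_closure w (fun l : nat => f`_l)) (@one_coef R) phi) :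
  exists C : 'I_r -> nat -> R[i],
    [/\ phi = kernel_comb w beta mult C,
        (forall (i : 'I_r) (j : nat), (j <= max_order w beta mult)%N ->
           i \in Iset w beta mult j ->
           innerw w phi (rep_kernel w j (beta i)) = 0)
      & (forall D : 'I_r -> nat -> R[i],
           (forall (i : 'I_r) (j : nat), (j <= max_order w beta mult)%N ->
              i \in Iset w beta mult j ->
              innerw w (kernel_comb w beta mult D) (rep_kernel w j (beta i)) = 0) ->
           forall (i : 'I_r) (j : nat), (j <= max_order w beta mult)%N ->
             i \in Iset w beta mult j -> D i j = C i j)].
Proof.
have [phiV phi_perp] := phi_proj.
have f_neq0 : f != 0 by rewrite monic_neq0.
have phi_zero i j : i \in Iset w beta mult j -> innerw w phi (rep_kernel w j (beta i)) = 0.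
  move=> /(mem_Iset beta_inj)[Om jm].
  have [_ ->] := rep_kernelP w_gt0 Om; last by case: phiV.
  by apply: (deriv_at_closure w_gt0 f) => //; rewrite -mup_geq// -mult_eq.
pose x l := one_coef R l - phi l.
have Hx : H2w w x.
  have [_ SD] := lincomb_stable_H2w _ w_gt0; case: phiV => Hphi _.
  have := SD (-1) _ _ Hphi (@H2w_one _ w).
  by under eq_fun do rewrite mulN1r addrC.
have [s [us sroot fE]] := monic_prod_mup _ _ f_monic.
have fx : poly_act f (dualize (w := w) x) = fun=> 0.
  by apply: orth_recurrence => n; apply: phi_perp; exact: mulzn_in_closure.
rewrite fE in fx.
have [|k [d [kd xE]]] :=
    recurrence_solution _ _ _ _ (shift_stable_dual w_gt0 w_ratio) _ us fx.
  by rewrite H2w_dualize.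
have s_beta : perm_eq s [seq beta i | i <- enum 'I_r].
  apply: uniq_perm => //; first by rewrite map_inj_uniq ?enum_uniq.
  move=> c; rewrite sroot; apply/idP/mapP => [/beta_roots[i ->]|[i _ ->]].
    by exists i; rewrite ?mem_enum.
  by apply/beta_roots; exists i.
(* Sequences occurring in the dual of x lie in the dual space, so their zeros are
   reproducible. *)
have kI i j : (j < k (beta i))%N -> i \in Iset w beta mult j.
  move=> jk; have bs : beta i \in s by rewrite sroot; apply/beta_roots; exists i.
  have [km /(_ _ jk) Sij] := kd _ bs.
  apply/(mem_Iset beta_inj); rewrite mult_eq; split; last exact: leq_trans jk km.
  exact: reproducible_dual.
have kN i : (k (beta i) <= (max_order w beta mult).+1)%N.
  case kE : (k (beta i)) => [//|n].
  by apply: (Iset_max_order (w := w) beta_inj i); apply: kI; rewrite kE.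
have w_neq0 l : (w l)%:C != 0 :> R[i] by rewrite (inj_eq (@complexI R)) gt_eqF.
(* phi = 1 - x and passing to the dual conjugates, hence the sign and the
   conjugate. *)
pose C i j := if (j < k (beta i))%N then - Num.conj (d (beta i) j) else 0.
have phiE : phi = kernel_comb w beta mult C.
  rewrite kernel_combE; apply/funext => l; set T := \sum_i _.
  suff -> : phi l = one_coef R l - x l.
    suff -> : x l = - T by rewrite opprK.
    apply: (can_inj (@conjCK R[i])); apply: (mulfI (w_neq0 l)).
    have /(congr1 (@^~ l)) := xE; rewrite (perm_big _ s_beta)/= big_map big_enum/=.
    rewrite {1}/dualize => ->; rewrite rmorphN mulrN rmorph_sum mulr_sumr -sumrN.
    apply: eq_bigr => i _; rewrite mul1r rmorph_sum mulr_sumr -sumrN.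
    rewrite (big_ord_widen _ (fun j => d (beta i) j * expmono j (beta i) l) (kN i)).
    rewrite big_mkcond; apply: eq_bigr => j _.
    rewrite rmorphM [(w l)%:C * _]mulrCA -mulNr.
    rewrite -/(dualize (w := w) (zero_kernel i j) l).
    rewrite (dualize_zero_kernel w_gt0 beta_inj) /C.
    case: ifPn => [/kI ->|_]; last by rewrite rmorph0 oppr0 mul0r.
    by rewrite rmorphN /= conjCK opprK.
  by rewrite /x subKr.
exists C; split=> //.
- by move=> i j _; exact: phi_zero.
- move=> D D0 i j jN iI; apply: (kernel_comb_unique w_gt0 beta_inj) iI => //.
    by move=> i' j' iI'; rewrite -phiE; exact: phi_zero.
  move=> i' j' iI'; apply: D0 => //; have := Iset_max_order beta_inj _ _ iI'.
  by rewrite ltnS.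
Qed.
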